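(* Let $n\ge1$ and let $G=\mathrm{PSL}(2,2^n)$ act on the $13$-subsets of $X=\mathrm{GF}(2^n)\cup\{\infty\}$. Then \[m_{572}=\begin{cases}\dfrac{(2^n-1)(2^n-4)(2^n-16)}{648} & \text{if } n \text{ is even},\\[2mm] 0 & \text{if } n\text{ is odd}.\end{cases}\]
   Context: $\mathrm{PSL}(2,2^n)$ is the group of all maps $X\to X$, $x\mapsto\frac{ax+b}{cx+d}$ with $a,b,c,d\in\mathrm{GF}(2^n)$, $ad-bc\neq0$ (usual conventions for $\infty$). For a $13$-subset $B$ of $X$, $G_B=\{g\in G: g(B)=B\}$ and $G(B)=\{g(B):g\in G\}$. Each orbit $G(B)$ is a simple $3$-$(2^n+1,13,\lambda_B)$ design (every $3$-subset of $X$ lies in exactly $\lambda_B$ members of $G(B)$), with $\lambda_B=1716/|G_B|$. $m_\lambda$ denotes the number of $G$-orbits $G(B)$ of $13$-subsets with $\lambda_B=\lambda$; so $m_{572}$ counts the orbits with $|G_B|=3$. *)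

(* Defs.v *)
From HB Require Import structures.
From mathcomp Require Import all_boot all_order all_algebra all_fingroup.
From mathcomp Require Import ring.

Set Implicit Arguments.
Unset Strict Implicit.
Unset Printing Implicit Defensive.

Import GRing.Theory.
Local Open Scope ring_scope.

Section ProjectiveLine.
Variable F : finFieldType.

(* X = F U {oo}; None is the point at infinity. *)
Definition proj_line : finType := option F.

Definition mobius (a b c d : F) (x : proj_line) : proj_line :=
  match x with
  | Some x => if c * x + d == 0 then None else Some ((a * x + b) / (c * x + d))
  | None => if c == 0 then None else Some (a / c)
  end.

Lemma mobius_comp a b c d a' b' c' d' (x : proj_line) :
    a * d - b * c != 0 -> a' * d' - b' * c' != 0 ->
  mobius a b c d (mobius a' b' c' d' x) =
  mobius (a * a' + b * c') (a * b' + b * d')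
         (c * a' + d * c') (c * b' + d * d') x.
Proof.
move=> hD hD'.
have key (p q : F) : (p, q) != (0, 0) ->
    mobius a b c d (if q == 0 then None else Some (p / q)) =
    if c * p + d * q == 0 then None
    else Some ((a * p + b * q) / (c * p + d * q)).
  case: (eqVneq q 0) => [-> | q0] pq.
    have p0 : p != 0 by apply: contraNneq pq => ->.
    rewrite /= !mulr0 !addr0 mulf_eq0 (negPf p0) orbF.
    by case: (eqVneq c 0) => // c0; congr Some; field; rewrite p0.
  have -> : c * p + d * q = (c * (p / q) + d) * q by field.
  rewrite /= mulf_eq0 (negPf q0) orbF.
  case: (eqVneq (c * (p / q) + d) 0) => // e0; congr Some.
  have -> : a * p + b * q = (a * (p / q) + b) * q by field.
  by rewrite -mulf_div divff // mulr1.
case: x => [x|].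
  rewrite {2}/mobius key; last first.
    apply: contraNneq hD' => -[e1 e2].
    have -> : a' * d' - b' * c' = a' * (c' * x + d') - c' * (a' * x + b') by ring.
    by rewrite e1 e2 !mulr0 subrr.
  have e u v : u * (a' * x + b') + v * (c' * x + d') =
      (u * a' + v * c') * x + (u * b' + v * d') by ring.
  by rewrite !e.
rewrite {2}/mobius key //.
by apply: contraNneq hD' => -[-> ->]; rewrite mul0r mulr0 subrr.
Qed.

Lemma mobius1 x : mobius 1 0 0 1 x = x.
Proof.
by case: x => [x|] /=; rewrite ?eqxx // mul0r add0r oner_eq0 mul1r addr0 divr1.
Qed.

Lemma mobius_scal e x : e != 0 -> mobius e 0 0 e x = x.
Proof.
move=> e0; case: x => [x|] /=; rewrite ?eqxx // mul0r add0r addr0 (negPf e0).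
by rewrite mulrC mulKf.
Qed.

Lemma mobius_inj a b c d : a * d - b * c != 0 -> injective (mobius a b c d).
Proof.
move=> hD; apply: (can_inj (g := mobius d (- b) (- c) a)) => x.
have hD' : d * a - - b * - c != 0 by rewrite mulrNN [d * a]mulrC.
rewrite mobius_comp //.
have -> : d * b + - b * d = 0 by ring.
have -> : - c * a + a * c = 0 by ring.
have -> : d * a + - b * c = a * d - b * c by ring.
have -> : - c * b + a * d = a * d - b * c by ring.
exact: mobius_scal.
Qed.

(* Every map with a * d - b * c != 0 is a permutation (mobius_inj), so no map is
   lost here. For odd #|F| these maps form PGL(2, F); when #|F| is a power of 2
   every element is a square and this is PSL(2, F). *)
Definition PSL2 : {set {perm proj_line}} :=
  [set s : {perm proj_line} | [exists a : F, exists b : F, exists c : F,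
     exists d : F,
     (a * d - b * c != 0) && [forall x, s x == mobius a b c d x]]].

Lemma PSL2P (s : {perm proj_line}) :
  reflect (exists a b c d, a * d - b * c != 0 /\ s =1 mobius a b c d)
          (s \in PSL2).
Proof.
rewrite inE; apply: (iffP existsP).
  case=> a /existsP[b /existsP[c /existsP[d /andP[hD /forallP hs]]]].
  by exists a, b, c, d; split=> // x; apply/eqP.
case=> a [b [c [d [hD hs]]]]; exists a.
apply/existsP; exists b; apply/existsP; exists c; apply/existsP; exists d.
by rewrite hD; apply/forallP => x; rewrite hs.
Qed.

Lemma PSL2_group_set : group_set PSL2.
Proof.
apply/group_setP; split.
  apply/PSL2P; exists 1, 0, 0, 1; split; first by rewrite mul1r mul0r subr0 oner_eq0.
  by move=> x; rewrite perm1 mobius1.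
move=> s t /PSL2P[a' [b' [c' [d' [hD' hs]]]]] /PSL2P[a [b [c [d [hD ht]]]]].
apply/PSL2P; exists (a * a' + b * c'), (a * b' + b * d'),
  (c * a' + d * c'), (c * b' + d * d'); split.
  have -> : (a * a' + b * c') * (c * b' + d * d') -
      (a * b' + b * d') * (c * a' + d * c') =
      (a * d - b * c) * (a' * d' - b' * c') by ring.
  by rewrite mulf_neq0.
by move=> x; rewrite permM hs ht mobius_comp.
Qed.

Canonical PSL2_group := Group PSL2_group_set.

End ProjectiveLine.

(* D is the block set of a simple t-(#|X|, k, lambda) design on X. *)
Definition is_design (X : finType) (t k lambda : nat) (D : {set {set X}}) :=
  [forall B in D, #|B| == k] &&
  [forall T : {set X}, (#|T| == t) ==>
     (#|[set B in D | T \subset B]| == lambda)].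

Definition PSL2_orbits (F : finFieldType) (k : nat) :
    {set {set {set proj_line F}}} :=
  [set orbit ('P^* )%act (PSL2 F) B | B in [set B : {set proj_line F} | #|B| == k]].

(* As #|proj_line F| >= 3, an orbit is a 3-design for at most one lambda. *)
Definition m_lambda (F : finFieldType) (k lambda : nat) : nat :=
  #|[set D in PSL2_orbits F k | is_design 3 k lambda D]|.

(* Main.v *)
Require Import Defs.
From mathcomp Require Import all_boot all_order all_algebra all_fingroup.
From mathcomp Require Import all_solvable all_field ring lra.

Set Implicit Arguments.
Unset Strict Implicit.
Unset Printing Implicit Defensive.

Import GRing.Theory.
Local Open Scope ring_scope.

(** Write q for the order of F, oo for the point at infinity and G for PSL2 F.

    An orbit of a 13-set B is a 3-design whose parameter lambda satisfies
    lambda |G_B| = 13 * 12 * 11 = 1716 (design_stab), by sharp triple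
    transitivity, so the orbits to be counted are those with |G_B| = 3.  A
    generator h of such a G_B has one fixed point in B, because it has at most
    two and 13 = 1 modulo 3.  If q = 2 modulo 3 then 3 divides q + 1, and h has no
    fixed point at all (orbit3_mod2): there is no such orbit.

    If q = 1 modulo 3 then F contains a primitive cube root of unity w, and h
    has two fixed points, which can be carried to oo (in B) and 0 (not in B).
    Then h becomes u |-> w u or its inverse, and B = {oo} u S with S a union of
    four cosets of mu3 = {1, w, w^2} (orbit3_normal_form).  With r = (q - 1) / 3
    there are C(r, 4) such sets S (card_invariant12).

    The crux is to decide which S give a stabiliser H larger than the group of
    order 3 generated by w: exactly those S with a nonzero period v, that is
    S + v = S (card_stab_no_trans).  Indeed, without periods H_oo has order 3.
    If oo had k > 1 images under H, their stabilisers would give 2 (k - 1)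
    elements of order 3 outside H_oo, so that one of the k - 1 nontrivial cosets
    of H_oo would contain two of them.  A matrix M of projective order 3 satisfies
    (tr M)^2 = det M (order3_trace), and in characteristic 2 this relation for two
    elements of the coset forces the product of the off-diagonal entries to
    vanish (coset_order3_uniq).  This produces either an element that fixes oo or
    an involution in H that fixes only 0; the first is absurd since the coset is
    not H_oo, the second since an involution has a fixed point in the set B of
    odd size.

    The periods of S form a line F4 v over the subfield with four elements, and
    S = mu3 x + F4 v for each x in S.  A pair (v, x) with v <> 0 and x outside
    F4 v determines S, and each S arises from 3 * 12 pairs; so there are
    (q - 1) (q - 4) / 36 sets with periods (card_periodic12).

    Finally, two sets S without periods give blocks in the same G-orbit if and
    only if they differ by a nonzero scalar (good12_orbit_scale), and the scalars
    preserving S are those of mu3, so each orbit contains r of these blocks.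
    Hence m r = C(r, 4) - r (r - 1) / 4 and m = r (r - 1) (r - 5) / 24. *)

(** * Sharp triple transitivity and the design parameter *)

Section SharplyTransitive.
Variable F : finFieldType.
Implicit Types (s t : {perm proj_line F}) (x y z : proj_line F).

Lemma mobius_perm (a b c d : F) : a * d - b * c != 0 ->
  exists2 s, s \in PSL2 F & s =1 mobius a b c d.
Proof.
move=> hD; exists (perm (mobius_inj hD)) => [|x]; last by rewrite permE.
by apply/PSL2P; exists a, b, c, d; split=> // x; rewrite permE.
Qed.

Lemma affine_perm (a b : F) : a != 0 ->
  exists2 s, s \in PSL2 F &
    s None = None /\ forall u, s (Some u) = Some (a * u + b).
Proof.
move=> a0; have [|s Gs sE] := @mobius_perm a b 0 1.
  by rewrite mulr1 mulr0 subr0.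
exists s => //; rewrite sE /= eqxx; split=> // u.
by rewrite sE /= mul0r add0r oner_eq0 divr1.
Qed.

Lemma PSL2_affine s : s \in PSL2 F -> s None = None ->
  exists a b : F, a != 0 /\ forall u, s (Some u) = Some (a * u + b).
Proof.
case/PSL2P=> a [b [c [d [hD sE]]]]; rewrite sE /=.
case: eqP => // c0 _; move: hD; rewrite c0 mulr0 subr0 mulf_eq0.
case/norP=> a0 d0; exists (a / d), (b / d); split=> [|u].
  by rewrite mulf_neq0 ?invr_eq0.
rewrite sE /= c0 mul0r add0r (negPf d0); congr Some.
by rewrite mulrDl mulrAC.
Qed.

Lemma PSL2_to_std x y z : x != y -> x != z -> y != z ->
  exists2 s, s \in PSL2 F & [/\ s x = None, s y = Some 0 & s z = Some 1].
Proof.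
move=> nxy nxz nyz.
have [s1 Gs1 s1x]: exists2 s, s \in PSL2 F & s x = None.
  case: x {nxy nxz} => [u|]; last by exists 1%g; rewrite ?group1 ?perm1.
  have [|s Gs sE] := @mobius_perm 0 1 1 (- u).
    by rewrite mul0r mul1r sub0r oppr_eq0 oner_eq0.
  by exists s; rewrite // sE /= mul1r subrr eqxx.
have [v s1y]: exists v, s1 y = Some v.
  case E: (s1 y) => [v|]; first by exists v.
  by case/eqP: nxy; apply: (@perm_inj _ s1); rewrite s1x E.
have [w s1z]: exists w, s1 z = Some w.
  case E: (s1 z) => [w|]; first by exists w.
  by case/eqP: nxz; apply: (@perm_inj _ s1); rewrite s1x E.
have nvw: w - v != 0.
  rewrite subr_eq0; apply: contraNneq nyz => wv.
  by apply/eqP/(@perm_inj _ s1); rewrite s1y s1z wv.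
have [|s2 Gs2 [s2N s2E]] := @affine_perm (w - v)^-1 (- (v / (w - v))).
  by rewrite invr_eq0.
exists (s1 * s2)%g; first exact: groupM.
rewrite !permM s1x s1y s1z s2N !s2E; split=> //; congr Some.
  by rewrite mulrC subrr.
by rewrite mulrC -mulrBl divff.
Qed.

Lemma PSL2_std_eq1 s : s \in PSL2 F ->
  s None = None -> s (Some 0) = Some 0 -> s (Some 1) = Some 1 -> s = 1%g.
Proof.
move=> Gs sN; have [a [b [_ sE]]] := PSL2_affine Gs sN.
rewrite !sE mulr0 add0r => -[b0] [ab]; apply/permP => -[u|]; last first.
  by rewrite perm1.
by rewrite perm1 sE b0 addr0 -[a]addr0 -{1}b0 -[a]mulr1 ab mul1r.
Qed.

Lemma PSL2_fix3_eq1 s x y z : s \in PSL2 F ->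
    x != y -> x != z -> y != z -> s x = x -> s y = y -> s z = z -> s = 1%g.
Proof.
move=> Gs nxy nxz nyz sx sy sz.
have [t Gt [tx ty tz]] := PSL2_to_std nxy nxz nyz.
suff: (s ^ t)%g = 1%g by move/eqP; rewrite conjg_eq1 => /eqP.
have sJ u v : t u = v -> s u = u -> (s ^ t)%g v = v.
  by move=> <- su; rewrite conjgE !permM permK su.
by apply: PSL2_std_eq1; rewrite ?groupJ //;
  [apply: sJ tx _ | apply: sJ ty _ | apply: sJ tz _].
Qed.

Lemma PSL2_card_fix s (A : {set proj_line F}) : s \in PSL2 F -> s != 1%g ->
  (#|'Fix_(A | 'P)[s]%g| <= 2)%N.
Proof.
move=> Gs; apply: contraNT; rewrite -ltnNge.
case/card_gt2P=> x [y [z [[fx fy fz] [nxy nyz nzx]]]].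
have fixE u : u \in 'Fix_(A | 'P)[s]%g -> s u = u by case/setIP=> _ /afix1P.
by apply/eqP/(PSL2_fix3_eq1 Gs nxy _ nyz); rewrite ?fixE // eq_sym.
Qed.

End SharplyTransitive.

(** Each point of the orbit that satisfies P is reached by one coset of the
    stabiliser of x. *)
Lemma card_act_preim (aT : finGroupType) (T : finType)
    (to : {action aT &-> T}) (G : {group aT}) (x : T) (P : pred T) :
  #|[set g in G | P (to x g)]| =
    (#|[set y in orbit to G x | P y]| * #|'C_G[x | to]%g|)%N.
Proof.
rewrite -sum1_card (partition_big (to x) [in [set y in orbit to G x | P y]])
  => /= [|g]; last by rewrite !inE => /andP[Gg ->]; rewrite mem_orbit.
rewrite -sum_nat_const; apply: eq_bigr => y /setIdP[/imsetP[g Gg ->] Py].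
rewrite -(card_rcoset _ g) -amove_act ?subsetT // -sum1_card.
apply: eq_bigl => h; rewrite [RHS]inE [h \in [set _ | _]]inE.
by case: eqP => [->|]; rewrite ?Py ?andbT ?andbF.
Qed.

Section DesignParameter.
Variable F : finFieldType.
Implicit Types (B T : {set proj_line F}).

Definition block_stab B : {set {perm proj_line F}} := 'N_(PSL2 F)(B | 'P)%g.
Canonical block_stab_group B := [group of block_stab B].

Lemma block_stabE B : block_stab B = 'C_(PSL2 F)[B | 'P^*]%g.
Proof. by rewrite astab1_set. Qed.

Lemma block_stabP B s :
  reflect (s \in PSL2 F /\ forall x, (s x \in B) = (x \in B))
          (s \in block_stab B).
Proof.
apply: (iffP setIP) => -[Gs]; [move/astabsP|]; move=> sB; split=> //.
exact/astabsP.
Qed.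

(** By sharp triple transitivity such an element g is determined by the inverse
    images under g of the three points of T, an arbitrary ordered triple of
    distinct points of B. *)
Lemma card_PSL2_into B T : #|T| = 3%N ->
  #|[set g in PSL2 F | T \subset ('P^*)%act B g]| = (#|B| ^_ 3)%N.
Proof.
move=> T3.
have [x [y [z [nxy nxz nyz ->]]]]: exists x y z,
    [/\ x != y, x != z, y != z & T = [set x; y; z]].
  have /card_gt2P[x [y [z [[Tx Ty Tz] [nxy nyz nzx]]]]] : (2 < #|T|)%N.
    by rewrite T3.
  exists x, y, z; split; rewrite // 1?eq_sym //; apply/eqP; rewrite eq_sym.
  rewrite eqEcard !subUset !sub1set Tx Ty Tz T3 /= setUC cardsU1 cards2.
  by rewrite !inE negb_or nzx nxy (eq_sym z) nyz.
pose f (g : {perm proj_line F}) := [tuple g^-1 x; g^-1 y; g^-1 z]%g.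
rewrite -[#|B|]/#|[in B]| -card_uniq_tuples -(@card_in_imset _ _ f) => [|g h].
  apply: eq_card => t; rewrite inE; apply/imsetP/andP.
    case=> g /setIdP[Gg sTB] ->.
    have inB u : u \in [set x; y; z] -> g^-1%g u \in B.
      by move/(subsetP sTB)/imsetP=> [v Bv ->]; rewrite /= apermE permK.
    by rewrite /= !inB ?inE ?eqxx ?orbT //= !(inj_eq perm_inj) !negb_or nxy nxz nyz.
  case/tupleP: t => u t; case/tupleP: t => v t; case/tupleP: t => w t.
  rewrite tuple0 /= !inE !negb_or andbT.
  case=> /and3P[Bu Bv Bw] /and3P[/andP[nuv nuw] nvw _].
  have [s1 Gs1 [s1x s1y s1z]] := PSL2_to_std nuv nuw nvw.
  have [s2 Gs2 [s2x s2y s2z]] := PSL2_to_std nxy nxz nyz.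
  have gu : (s1 * s2^-1)%g u = x by rewrite permM s1x -s2x permK.
  have gv : (s1 * s2^-1)%g v = y by rewrite permM s1y -s2y permK.
  have gw : (s1 * s2^-1)%g w = z by rewrite permM s1z -s2z permK.
  exists (s1 * s2^-1)%g; last by apply: val_inj; rewrite /= -gu -gv -gw !permK.
  rewrite inE groupM ?groupV //=; apply/subsetP => p; rewrite !inE -!orbA.
  by case/or3P=> /eqP->; [rewrite -gu | rewrite -gv | rewrite -gw];
    apply: (mem_setact 'P).
case/setIdP=> Gg _ /setIdP[Gh _] [ex ey ez].
have fixV u : (g^-1)%g u = (h^-1)%g u -> (h^-1 * g)%g u = u.
  by move=> e; rewrite permM -e permKV.
have e1 : (h^-1 * g)%g = 1%g.
  by apply: (PSL2_fix3_eq1 _ nxy nxz nyz); rewrite ?fixV // groupM ?groupV.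
by rewrite -[g](mulKVg h) e1 mulg1.
Qed.

(** The 1716 elements g of PSL2 with T in g(B) fall into classes of size |G_B|,
    one for each block containing T. *)
Lemma design_stab B lambda : #|B| = 13%N ->
  is_design 3 13 lambda (orbit ('P^*)%act (PSL2 F) B) =
    (lambda * #|block_stab B| == 1716)%N.
Proof.
move=> B13; have cnt T : #|T| = 3%N ->
    (#|[set B' in orbit ('P^*)%act (PSL2 F) B | T \subset B']| *
       #|block_stab B| = 1716%N)%N.
  by move=> T3; rewrite block_stabE -card_act_preim card_PSL2_into // B13.
have [T0 T03]: exists T : {set proj_line F}, #|T| = 3%N.
  have: (0 < #|[set A : {set proj_line F} | A \subset B & #|A| == 3]|)%N.
    by rewrite cards_draws B13.
  by case/card_gt0P=> T /setIdP[_ /eqP T3]; exists T.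
have H0 : (0 < #|block_stab B|)%N := cardG_gt0 (block_stab_group B).
rewrite /is_design.
apply/andP/eqP => [[_ /forallP/(_ T0)]|lamE].
  by rewrite T03 eqxx => /eqP <-; apply: cnt.
split.
  by apply/forall_inP => _ /imsetP[g _ ->]; rewrite card_setact B13.
apply/forallP => T; apply/implyP => /eqP T3.
by rewrite -(eqn_pmul2r H0) lamE cnt.
Qed.

End DesignParameter.

(** * Stabilisers of blocks *)

Section FixedPoints.
Variable F : finFieldType.
Implicit Types (s : {perm proj_line F}) (B : {set proj_line F}).

Lemma acts_cycle s B : s \in 'N(B | 'P)%g -> [acts <[s]>, on B | 'P]%g.
Proof. by move=> nBs; rewrite cycle_subG. Qed.

(** An element of order 3 has at most two fixed points, and their number in B
    is congruent to 13 modulo 3. *)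
Lemma order3_card_fix B s : #|B| = 13%N -> s \in block_stab B -> #[s]%g = 3%N ->
  #|'Fix_(B | 'P)[s]%g| = 1%N.
Proof.
move=> B13 /setIP[Gs nBs] s3.
have le2 : (#|'Fix_(B | 'P)[s]%g| <= 2)%N.
  by apply: PSL2_card_fix; rewrite // -order_eq1 s3.
have p3 : (3.-group <[s]>)%g by rewrite /pgroup [#|_|]s3.
have := pgroup_fix_mod p3 (acts_cycle nBs); rewrite B13 afix_cycle.
by case: #|_| le2 => [|[|[|n]]].
Qed.

Lemma order3_fix_uniq B s x y : #|B| = 13%N -> s \in block_stab B ->
  #[s]%g = 3%N -> x \in B -> y \in B -> s x = x -> s y = y -> x = y.
Proof.
move=> B13 Hs s3 Bx By sx sy.
have /eqP/cards1P[z fixE] := order3_card_fix B13 Hs s3.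
have fixz u : u \in B -> s u = u -> u = z.
  by move=> Bu su; apply/set1P; rewrite -fixE inE Bu; apply/afix1P.
by rewrite (fixz x) // (fixz y).
Qed.

Lemma involution_fix B s : odd #|B| -> s \in 'N(B | 'P)%g -> (s ^+ 2 = 1)%g ->
  exists2 x, x \in B & s x = x.
Proof.
move=> oddB nBs s2.
have p2 : (2.-group <[s]>)%g.
  apply: (@pnat_dvd _ 2); last by rewrite pnat_id.
  by rewrite [#|_|](erefl #[s]%g) order_dvdn s2.
have := pgroup_fix_mod p2 (acts_cycle nBs); rewrite !modn2 oddB afix_cycle.
case: (set_0Vmem 'Fix_(B | 'P)[s]%g) => [->|[x /setIP[Bx /afix1P sx]] _].
  by rewrite cards0.
by exists x.
Qed.

End FixedPoints.

Section Trace.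
Variable F : finFieldType.
Implicit Types (a b c d : F).

Lemma mobius_id_scalar a b c d : a * d - b * c != 0 ->
  mobius a b c d =1 id -> [/\ b = 0, c = 0 & a = d].
Proof.
move=> hD idM; have c0: c = 0 by move: (idM None) => /=; case: eqP.
have d0: d != 0 by apply: contraNneq hD => ->; rewrite c0 !mulr0 subr0.
have bd u : (a * u + b) / d = u.
  by move: (idM (Some u)); rewrite /= c0 mul0r add0r (negPf d0) => -[].
have b0: b = 0.
  by have /(congr1 ( *%R^~ d)) := bd 0; rewrite mulfVK // mulr0 add0r mul0r.
by have /(congr1 ( *%R^~ d)) := bd 1; rewrite mulfVK // b0 mulr1 addr0 mul1r.
Qed.

(** By Cayley-Hamilton the cube of a matrix M with trace t and determinant D is
    (t ^ 2 - D) M - t D, so it is scalar only if M is scalar or t ^ 2 = D. *)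
Lemma order3_trace (s : {perm proj_line F}) a b c d :
    a * d - b * c != 0 -> s =1 mobius a b c d -> s != 1%g -> (s ^+ 3)%g = 1%g ->
  (a + d) ^+ 2 = a * d - b * c.
Proof.
move=> hD sE s1 s3; apply/eqP; rewrite -subr_eq0; apply: contraNT s1 => tD.
pose a2 := a * a + b * c; pose b2 := a * b + b * d.
pose c2 := c * a + d * c; pose d2 := c * b + d * d.
have hD2 : a2 * d2 - b2 * c2 != 0.
  have -> : a2 * d2 - b2 * c2 = (a * d - b * c) ^+ 2.
    by rewrite /a2 /b2 /c2 /d2; ring.
  by rewrite expf_neq0.
have hD3 : (a * a2 + b * c2) * (c * b2 + d * d2) -
    (a * b2 + b * d2) * (c * a2 + d * c2) != 0.
  have -> : (a * a2 + b * c2) * (c * b2 + d * d2) -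
      (a * b2 + b * d2) * (c * a2 + d * c2) =
      (a * d - b * c) * (a2 * d2 - b2 * c2) by ring.
  by rewrite mulf_neq0.
have [|b3 c3 ad3] := mobius_id_scalar hD3.
  move=> x; rewrite -mobius_comp // -mobius_comp // -!sE.
  by rewrite -[RHS](perm1 x) -s3 permX /=.
have b0 : b = 0.
  apply: (mulfI tD); rewrite mulr0 -b3 /a2 /b2 /c2 /d2; ring.
have c0 : c = 0.
  apply: (mulfI tD); rewrite mulr0 -c3 /a2 /b2 /c2 /d2; ring.
have ad : a = d.
  apply: (mulfI tD); apply/eqP; rewrite -subr_eq0.
  apply/eqP; rewrite -[RHS](subrr (a * a2 + b * c2)) {2}ad3.
  rewrite /a2 /b2 /c2 /d2; ring.
apply/eqP/permP => x; rewrite sE perm1 b0 c0 ad mobius_scal //.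
by apply: contraNneq hD => d0; rewrite ad b0 d0 !mul0r subr0.
Qed.

End Trace.

Lemma card_free_dvdn (aT : finGroupType) (T : finType)
    (to : {action aT &-> T}) (G : {group aT}) (S : {set T}) :
    [acts G, on S | to]%g -> {in S, forall x, 'C_G[x | to]%g = 1%g} ->
  (#|G| %| #|S|)%N.
Proof.
move=> nSG free; rewrite -(acts_sum_card_orbit nSG).
apply: dvdn_sum => _ /imsetP[x Sx ->].
by rewrite card_orbit free ?indexg1.
Qed.


(** * Blocks invariant under a cube root of unity *)

Section Blocks.
Variable F : finFieldType.
Implicit Types (S : {set F}) (u : F).

Definition block S : {set proj_line F} := None |: [set Some u | u in S].

Lemma block_inf S : None \in block S.
Proof. exact: setU11. Qed.

Lemma block_some S u : (Some u \in block S) = (u \in S).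
Proof.
rewrite in_setU1 /=; apply/imsetP/idP => [[v Sv [->]] //|Su].
by exists u.
Qed.

Lemma card_block S : #|block S| = #|S|.+1.
Proof.
rewrite cardsU1 card_imset; last by move=> ? ? [].
by case: imsetP => // -[].
Qed.

Lemma block_inj : injective block.
Proof. by move=> S S' eSS; apply/setP=> u; rewrite -!block_some eSS. Qed.

Lemma affine_stab S a b (s : {perm proj_line F}) : s \in PSL2 F ->
    s None = None -> (forall u, s (Some u) = Some (a * u + b)) ->
  (s \in block_stab (block S)) = [forall u in S, a * u + b \in S].
Proof.
move=> Gs sN sE; rewrite inE Gs /= !inE /=.
apply/subsetP/forall_inP => [sB u Su|sS [u|]].
- by have := sB (Some u); rewrite block_some inE apermE sE block_some => ->.
- by rewrite block_some inE apermE sE block_some => /sS.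
- by rewrite block_inf inE apermE sN block_inf.
Qed.

End Blocks.

Section CubeRoot.
Variables (F : finFieldType) (w : F).
Hypotheses (char2 : 2 \in [pchar F]) (w3 : w ^+ 3 = 1) (w1 : w != 1).

Let two0 : 2%:R = 0 :> F := pcharf0 char2.

Lemma cube_root_neq0 : w != 0.
Proof. by apply: contra_eq_neq w3 => ->; rewrite expr0n eq_sym oner_eq0. Qed.

(** A block stabilised by u |-> w u and by no translation has a stabiliser H of
    order 3; Hoo is the subgroup of H fixing infinity. *)
Section Stabiliser.
Variable S : {set F}.
Hypotheses (S0 : 0 \notin S) (S12 : #|S| = 12%N).
Hypothesis wS : {in S, forall u, w * u \in S}.
Hypothesis noTrans : forall v, {in S, forall u, u + v \in S} -> v = 0.

Local Notation H := (block_stab_group (block S)).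
Local Notation Hoo := ('C_H[None | 'P]%G).

Let S_neq0 u : u \in S -> u != 0.
Proof. by apply: contraTneq => ->. Qed.

Lemma block_card13 : #|block S| = 13%N.
Proof. by rewrite card_block S12. Qed.

(** The commutator of an affine map and the multiplication by w is a
    translation, so the affine maps in H are linear. *)
Lemma stab_inf_linear s : s \in Hoo ->
  exists2 a, a != 0 & forall u, s (Some u) = Some (a * u).
Proof.
case/setIP=> Hs /astab1P; rewrite /= apermE => sN.
have Gs : s \in PSL2 F by case/setIP: Hs.
have [a [b [a0 sE]]] := PSL2_affine Gs sN.
exists a => // u; suff b0 : b = 0 by rewrite sE b0 addr0.
have aS : {in S, forall u, a * u + b \in S}.
  by apply/forall_inP; rewrite -(affine_stab _ Gs sN sE).
have wb0 : (w - 1) * b = 0.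
  apply: noTrans => v.
  have [injf onS] : injective (fun u => a * (w * u) + b) /\
      [set a * (w * u) + b | u in S] = S.
    split=> [u1 u2 /addIr/(mulfI a0)/(mulfI cube_root_neq0) //|].
    apply/eqP; rewrite eqEcard card_imset ?leqnn ?andbT.
      by apply/subsetP=> _ /imsetP[x Sx ->]; rewrite aS ?wS.
    by move=> u1 u2 /addIr/(mulfI a0)/(mulfI cube_root_neq0).
  rewrite -{1}onS => /imsetP[x Sx ->].
  have -> : a * (w * x) + b + (w - 1) * b = w * (a * x + b) by ring.
  by rewrite wS ?aS.
by move/eqP: wb0; rewrite mulf_eq0 subr_eq0 (negPf w1) => /eqP.
Qed.

Lemma stab_inf_fix s u : s \in Hoo -> u \in S -> s (Some u) = Some u -> s = 1%g.
Proof.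
move=> Hs Su; have [a a0 sE] := stab_inf_linear Hs; rewrite sE => -[au].
have a1 : a = 1 by apply: (mulIf (S_neq0 Su)); rewrite mul1r.
case/setIP: Hs => _ /astab1P /= sN.
by apply/permP=> -[v|]; rewrite perm1; [rewrite sE a1 mul1r | apply: sN].
Qed.

(** Hoo acts freely on the 12 points of S, contains u |-> w u, and has no
    involution because a ^ 2 = 1 implies a = 1.  So its order divides 12, is
    divisible by 3 and is odd. *)
Lemma card_stab_inf : #|Hoo| = 3%N.
Proof.
have dvd12 : (#|Hoo| %| 12)%N.
  have <- : #|[set Some u | u in S]| = 12%N by rewrite card_imset //; apply: Some_inj.
  apply: (@card_free_dvdn _ _ 'P) => [|_ /imsetP[u Su ->]].
    apply/subsetP=> s /setIP[Hs /astab1P sN].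
    apply/astabsP => x; have /block_stabP[_ /(_ x)] := Hs.
    case: x => [u|_]; last by rewrite sN.
    case E: (s (Some u)) => [v|]; last first.
      by have := perm_inj (etrans E (esym sN)).
    by rewrite /= apermE E !block_some => sB; rewrite !(mem_imset _ _ Some_inj).
  apply/trivgP/subsetP=> s /setIP[Hs /astab1P su]; apply/set1P.
  exact: stab_inf_fix Hs Su su.
have odd_Hoo : ~~ (2 %| #|Hoo|)%N.
  apply/negP => /(Cauchy (isT : prime 2))[s Hs s2].
  have [a a0 sE] := stab_inf_linear Hs.
  have [u Su] : exists u, u \in S by apply/set0Pn; rewrite -card_gt0 S12.
  suff s1: s = 1%g by rewrite s1 order1 in s2.
  apply: (stab_inf_fix Hs Su).
  have: (s ^+ 2)%g (Some u) = Some u by rewrite -s2 expg_order perm1.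
  rewrite expgS expg1 permM !sE => -[]; rewrite mulrA -{2}[u]mul1r.
  move/(mulIf (S_neq0 Su)) => a2; congr Some; suff -> : a = 1 by rewrite mul1r.
  apply/eqP; rewrite -subr_eq0 -sqrf_eq0; apply/eqP.
  have -> : (a - 1) ^+ 2 = a * a - 1 + 2%:R * (1 - a) by ring.
  by rewrite two0 mul0r addr0 a2 subrr.
have dvd3 : (3 %| #|Hoo|)%N.
  have [s Gs [sN sE]] := affine_perm 0 cube_root_neq0.
  have Hs : s \in Hoo.
    rewrite inE; apply/andP; split; last exact/astab1P.
    rewrite (affine_stab _ Gs sN sE); apply/forall_inP => u Su.
    by rewrite addr0 wS.
  suff <- : #[s]%g = 3%N by exact: order_dvdG.
  have s3 : (s ^+ 3 = 1)%g.
    apply/permP => -[u|]; rewrite permX /= perm1 ?sN // !sE.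
    by rewrite !addr0 !mulrA -!expr2 -exprSr w3 mul1r.
  apply: (nt_prime_order (isT : prime 3) s3).
  apply: contra_neq w1 => s1; have := sE 1.
  by rewrite s1 perm1 mulr1 addr0 => -[].
have := @dvdn_leq _ 12 isT dvd12; move: dvd12 odd_Hoo dvd3; move: #|_| => d.
by do 13?[case: d => // d].
Qed.

Local Notation O := (orbit 'P H None).

Lemma orbit_block y : y \in O -> y \in block S.
Proof.
case/imsetP=> s /block_stabP[_ sB] ->.
by rewrite /= apermE sB block_inf.
Qed.

Lemma card_stab_orbit y : y \in O -> #|'C_H[y | 'P]%g| = 3%N.
Proof.
move=> Oy; have := card_orbit_stab 'P H y; rewrite -(card_orbit_stab 'P H None).
move/orbit_eqP: Oy => ->; rewrite card_stab_inf => /eqP.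
by rewrite eqn_pmul2l ?card_orbit ?indexg_gt0 // => /eqP.
Qed.

Lemma stab_inf_cubic s : s \in Hoo -> 
  exists2 a, a ^+ 3 = 1 & forall u, s (Some u) = Some (a * u).
Proof.
move=> Hs; have [a a0 sE] := stab_inf_linear Hs; exists a => //.
have: (s ^+ 3)%g (Some 1) = Some 1 by rewrite -card_stab_inf expg_cardG // perm1.
rewrite permX /= !sE => -[]; rewrite mulr1 => <-.
by rewrite !exprS expr0 mulr1.
Qed.

Lemma orbit_elt y s : y \in O :\ None -> s \in ('C_H[y | 'P]^#)%g ->
  [/\ s \in H, s y = y, s None != None, s != 1%g & (s ^+ 3 = 1)%g].
Proof.
case/setD1P=> y_oo Oy /setD1P[s1 Cs]; have [Hs /astab1P sy] := setIP Cs.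
split=> //; last by rewrite -(card_stab_orbit Oy) expg_cardG.
apply: contraNneq s1 => sN; case: y y_oo Oy Cs sy => // u _ Ou _ su.
have Su : u \in S by rewrite -block_some orbit_block.
by rewrite (stab_inf_fix _ Su su) // inE Hs; apply/astab1P.
Qed.

(** If h and h * k have order 3, with k <> 1 in Hoo, then the trace identity for the
    matrices of both says that the matrix of h is triangular.  It is not upper
    triangular since h moves infinity; if it were lower triangular, then
    h * k ^ 2 would be an involution of the block whose only fixed point is 0,
    which is not in the block. *)
Lemma coset_order3_uniq h k : h \in H -> k \in Hoo -> h None != None ->
    h != 1%g -> (h ^+ 3 = 1)%g -> (h * k)%g != 1%g -> ((h * k) ^+ 3 = 1)%g ->
  k = 1%g.
Proof.
move=> Hh Hk hN h1 h3 hk1 hk3; have [Hk' /astab1P kN] := setIP Hk.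
have [c c3 kE] := stab_inf_cubic Hk; move: kN => /= kN.
apply/eqP; apply: contraNT hN => k1.
have {k1}c1 : c != 1.
  apply: contraNneq k1 => c1; apply/eqP/permP => -[u|]; rewrite perm1 //.
  by rewrite kE c1 mul1r.
have {c1}cc : c ^+ 2 + c + 1 = 0.
  have cB1 : c - 1 != 0 by rewrite subr_eq0.
  apply: (mulfI cB1); have -> : (c - 1) * (c ^+ 2 + c + 1) = c ^+ 3 - 1 by ring.
  by rewrite c3 subrr mulr0.
have c0 : c != 0.
  by apply: contra_eq_neq cc => ->; rewrite expr0n !add0r oner_eq0.
have [Gh hB] := block_stabP _ _ Hh.
have [a [b [g [d [hD hE]]]]] := PSL2P _ Gh.
have kM : k =1 mobius c 0 0 1.
  by case=> [u|]; rewrite ?kE ?kN /= ?eqxx // mul0r add0r oner_eq0 addr0 divr1.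
have kD : c * 1 - 0 * 0 != 0 by rewrite mulr1 mul0r subr0.
have hkE x : (h * k)%g x = mobius (c * a) (c * b) g d x.
  by rewrite permM kM hE mobius_comp //; congr (mobius _ _ _ _ x); ring.
have hkD : c * a * d - c * b * g != 0.
  by rewrite -!mulrA -mulrBr mulf_neq0.
have tr1 := order3_trace hD hE h1 h3.
have tr2 := order3_trace hkD hkE hk1 hk3.
(* The two trace identities give tr(h k)^2 = c det h = (c^2 tr h)^2, and squaring
   is injective in characteristic 2. *)
have x0 : c * a + d - c ^+ 2 * (a + d) = 0.
  apply/eqP; rewrite -sqrf_eq0; apply/eqP.
  have -> : (c * a + d - c ^+ 2 * (a + d)) ^+ 2 =
    (c * a + d) ^+ 2 - c * c ^+ 3 * (a + d) ^+ 2 +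
    2%:R * (c ^+ 2 * (a + d) * (c ^+ 2 * (a + d) - (c * a + d))) by ring.
  by rewrite tr1 tr2 c3 two0; ring.
have {x0}acd : a = c * d.
  have -> : a = c * a + d - c ^+ 2 * (a + d) - 2%:R * (c * a + d + c * d) +
    (c ^+ 2 + c + 1) * (a + d) + c * d by ring.
  by rewrite x0 two0 cc; ring.
have /eqP : b * g = 0.
  rewrite -[b * g](subKr (a * d)) -tr1 acd.
  have -> : c * d * d - (c * d + d) ^+ 2 = - ((c ^+ 2 + c + 1) * d ^+ 2) by ring.
  by rewrite cc mul0r oppr0.
rewrite mulf_eq0 orbC => /orP[/eqP g0|/eqP b0]; first by rewrite hE /= g0 eqxx.
have g0 : g = 0.
  (* Up to a scalar, h * k ^ 2 has the rows (d, 0) and (g, d). *)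
  have Ht : (h * k ^+ 2)%g \in H by rewrite groupM ?groupX.
  have tE x : (h * k ^+ 2)%g x = mobius d 0 g d x.
    rewrite expgS expg1 mulgA permM hkE kM mobius_comp // b0 acd.
    congr (mobius _ _ _ _ x); try ring.
    have -> : c * (c * (c * d)) + 0 * g = c ^+ 3 * d by ring.
    by rewrite c3 mul1r.
  have dd : d * d - 0 * g != 0.
    rewrite mul0r subr0; apply: contraNneq hD => dd.
    by rewrite acd b0 mul0r subr0 -mulrA dd mulr0.
  have d0 : d != 0 by apply: contraNneq dd => ->; rewrite !mul0r subr0.
  have t2 : ((h * k ^+ 2) ^+ 2 = 1)%g.
    apply/permP=> x; rewrite expgS expg1 permM perm1 !tE mobius_comp //.
    have -> : g * d + d * g = 2%:R * (d * g) by ring.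
    rewrite two0 !mul0r !mulr0 !addr0 add0r mobius_scal //.
    by rewrite mulf_neq0.
  have oddB : odd #|block S| by rewrite block_card13.
  have nBt : (h * k ^+ 2)%g \in 'N(block S | 'P)%g by case/setIP: Ht.
  have [[u|] Bx] := involution_fix oddB nBt t2; rewrite tE /=; last first.
    by case: eqP.
  case: eqP => // gud [] /(congr1 ( *%R^~ (g * u + d))).
  rewrite mulfVK; last exact/eqP.
  move/eqP; rewrite addr0 -subr_eq0.
  have -> : d * u - u * (g * u + d) = - (g * u ^+ 2) by ring.
  rewrite oppr_eq0 mulf_eq0 sqrf_eq0.
  have -> : (u == 0) = false by apply/negbTE/S_neq0; rewrite -block_some.
  by rewrite orbF => /eqP.
by rewrite hE /= g0 eqxx.
Qed.

(** The orbit O of infinity has |O| - 1 further points, each fixed by two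
    elements of order 3.  The preimage of infinity under such an element h is
    again one of these points; it determines the coset of Hoo containing h, and
    hence h.  So 2 (|O| - 1) <= |O| - 1, that is O = {infinity} and H = Hoo. *)
Lemma card_stab_no_trans : #|H| = 3%N.
Proof.
pose P := [set p : proj_line F * {perm proj_line F} |
  (p.1 \in O :\ None) && (p.2 \in ('C_H[p.1 | 'P]^#)%g)].
have cardP : #|P| = (#|O :\ None| * 2)%N.
  have -> : #|P| = (\sum_(y in O :\ None) \sum_(s in ('C_H[y | 'P]^#)%g) 1)%N.
    by rewrite pair_big_dep -sum1_card; apply: eq_bigl => p; rewrite [LHS]inE.
  rewrite -sum_nat_const; apply: eq_bigr => y /setD1P[_ Oy].
  rewrite sum1_card; have := cardsD1 1%g 'C_H[y | 'P]%g.
  by rewrite card_stab_orbit // group1 add1n => -[<-].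
have leP : (#|P| <= #|O :\ None|)%N.
  pose f (p : proj_line F * {perm proj_line F}) := p.2^-1%g None.
  rewrite -(@card_in_imset _ _ f) => [|[y h] [y' h']].
    apply/subset_leq_card/subsetP => _ /imsetP[[y h] + ->].
    rewrite inE => /andP[/= Oy Ch]; have [Hh _ hN _ _] := orbit_elt Oy Ch.
    rewrite in_setD1; apply/andP; split.
      by apply: contraNneq hN => hN; rewrite -{1}hN permKV.
    by apply/imsetP; exists h^-1%g; rewrite ?groupV.
  rewrite [in X in X -> _]inE [(y', _) \in _]inE /f /=.
  move=> /andP[Oy Ch] /andP[Oy' Ch'] hh'.
  have [Hh hy hN h1 h3] := orbit_elt Oy Ch.
  have [Hh' hy' _ h1' h3'] := orbit_elt Oy' Ch'.
  have Hk : (h^-1 * h')%g \in Hoo.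
    rewrite inE groupM ?groupV //; apply/astab1P.
    by rewrite /= apermE permM hh' permKV.
  have hk := mulKVg h h'.
  have k1 : (h^-1 * h')%g = 1%g.
    by apply: (coset_order3_uniq Hh Hk hN h1 h3); rewrite hk.
  move: hk; rewrite k1 mulg1 => hh; congr (_, _) => //.
  have o3 : #[h]%g = 3%N by apply: nt_prime_order h3 h1.
  apply: (order3_fix_uniq block_card13 Hh o3) => //; last by rewrite hh.
    by apply: orbit_block; case/setD1P: Oy.
  by apply: orbit_block; case/setD1P: Oy'.
have O1 : #|O| = 1%N.
  rewrite (cardsD1 None) orbit_refl; move: leP; rewrite cardP muln2 -addnn.
  by rewrite -{3}[#|_|]addn0 leq_add2l leqn0 => /eqP->.
by rewrite -(card_orbit_stab 'P H None) O1 card_stab_inf.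
Qed.

End Stabiliser.
End CubeRoot.


(** * Counting the invariant sets *)

Section Counting.
Variables (F : finFieldType) (w : F).
Implicit Types (S T : {set F}).
Hypotheses (char2 : 2 \in [pchar F]) (w3 : w ^+ 3 = 1) (w1 : w != 1).

Let two0 : 2%:R = 0 :> F := pcharf0 char2.

Lemma cube_root_min : w ^+ 2 + w + 1 = 0.
Proof.
have wB1 : w - 1 != 0 by rewrite subr_eq0.
apply: (mulfI wB1); have -> : (w - 1) * (w ^+ 2 + w + 1) = w ^+ 3 - 1 by ring.
by rewrite w3 subrr mulr0.
Qed.

Let w0 : w != 0 := cube_root_neq0 w3.

Definition mu3 : {set F} := [set c | c ^+ 3 == 1].

Lemma mu3_enum : mu3 = [set 1; w; w ^+ 2].
Proof.
apply/setP=> c; rewrite !inE -subr_eq0.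
have -> : c ^+ 3 - 1 = (c - 1) * (c - w) * (c - w ^+ 2) +
    (w ^+ 2 + w + 1) * (c ^+ 2 - c * w) + (w ^+ 3 - 1) by ring.
by rewrite cube_root_min w3 subrr mul0r !addr0 !mulf_eq0 !subr_eq0.
Qed.

Lemma card_mu3 : #|mu3| = 3%N.
Proof.
have w2 : w ^+ 2 != 1.
  by apply: contra_eq_neq w3 => w2; rewrite exprS w2 mulr1.
have ww2 : w != w ^+ 2.
  by rewrite -{1}[w]mulr1 expr2 (inj_eq (mulfI w0)) eq_sym.
rewrite mu3_enum setUC cardsU1 cards2 !inE negb_or w2.
by rewrite (eq_sym _ w) ww2 eq_sym w1.
Qed.

Definition cubes : {set F} := [set x ^+ 3 | x in [set~ 0]].

(** The nonempty fibres of the cube map are cosets of mu3. *)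
Lemma card_cube_preim (T : {set F}) : T \subset cubes ->
  #|[set x | x ^+ 3 \in T]| = (#|T| * 3)%N.
Proof.
move=> sT; rewrite -sum1_card (partition_big (fun x => x ^+ 3) [in T]) /=.
  rewrite -sum_nat_const; apply: eq_bigr => y Ty.
  have /imsetP[x0 + yE] := subsetP sT y Ty; rewrite !inE => x00.
  transitivity #|[set x0 * c | c in mu3]|.
    rewrite -sum1_card.
    apply: eq_bigl => x; rewrite inE; apply/andP/imsetP => [[_ /eqP xy]|[c]].
      exists (x / x0); last by rewrite mulrC divfK.
      by rewrite inE exprMn exprVn xy yE divff // expf_neq0.
    by rewrite inE => /eqP c3 ->; rewrite exprMn c3 mulr1 -yE.
  by rewrite card_imset ?card_mu3 //; apply: mulfI.
by move=> x; rewrite inE.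
Qed.

Lemma card_cubes : (#|cubes| * 3 = #|F|.-1)%N.
Proof.
rewrite -card_cube_preim // -(cardsC1 (0 : F)); apply: eq_card => x.
rewrite !inE; apply/imsetP/idP => [[y]|x0]; last by exists x; rewrite ?inE.
rewrite !inE => y0 xy; apply: contraNneq y0 => x0.
by move/eqP: xy; rewrite x0 expr0n eq_sym expf_eq0.
Qed.

(** As 0 is not in S, infinity is the only point of the block of S that is fixed
    by u |-> w u. *)
Definition invariant12 : {set {set F}} :=
  [set S : {set F} | [&& 0 \notin S, #|S| == 12 & [forall u in S, w * u \in S]]].

Lemma invariant12P (S : {set F}) :
  reflect [/\ 0 \notin S, #|S| = 12%N & {in S, forall u, w * u \in S}]
          (S \in invariant12).
Proof.
rewrite inE; apply: (iffP and3P) => -[S0 /eqP S12 wS]; split=> //;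
  exact/forall_inP.
Qed.

Lemma invariant12_mu3 (S : {set F}) c u :
  S \in invariant12 -> c \in mu3 -> u \in S -> c * u \in S.
Proof.
case/invariant12P=> _ _ wS; rewrite mu3_enum !inE -orbA.
case/or3P=> /eqP-> Su; first by rewrite mul1r.
  exact: wS.
by rewrite expr2 -mulrA !wS.
Qed.

(** Such a set is the inverse image under the cube map of a set of four nonzero
    cubes. *)
Lemma card_invariant12 : #|invariant12| = 'C(#|cubes|, 4).
Proof.
rewrite -cards_draws.
rewrite -(@card_in_imset _ _ (fun T : {set F} => [set x | x ^+ 3 \in T])).
  apply: eq_card => S; apply/idP/imsetP => [invS|[T]].
    have [S0 S12 wS] := invariant12P _ invS.
    have SE : S = [set x | x ^+ 3 \in [set u ^+ 3 | u in S]].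
      apply/setP=> x; rewrite inE; apply/idP/imsetP => [Sx|[u Su xu]].
        by exists x.
      have u0 : u != 0 by apply: contraNneq S0 => <-.
      rewrite -[x](divfK u0) (invariant12_mu3 invS) // inE.
      by rewrite exprMn exprVn xu divff // expf_neq0.
    have sT : [set u ^+ 3 | u in S] \subset cubes.
      by apply: imsetS; apply/subsetP=> u Su; rewrite !inE; apply: contraNneq S0 => <-.
    exists [set u ^+ 3 | u in S] => //; rewrite inE sT /=.
    have /eqP := card_cube_preim sT.
    by rewrite -SE S12 -[12%N]/(4 * 3)%N eqn_pmul2r // eq_sym.
  case/setIdP=> sT /eqP T4 ->; apply/invariant12P; split.
  - rewrite inE expr0n; apply/negP=> /(subsetP sT)/imsetP[x].
    by rewrite !inE => x0 /esym/eqP; rewrite expf_eq0 (negPf x0) andbF.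
  - by rewrite card_cube_preim // T4.
  - by move=> u; rewrite !inE exprMn w3 mul1r.
have inj (T T' : {set F}) : T \subset cubes ->
    [set x | x ^+ 3 \in T] = [set x | x ^+ 3 \in T'] -> T \subset T'.
  move=> sT eTT; apply/subsetP=> y Ty.
  have /imsetP[x _ yE] := subsetP sT y Ty.
  by move/setP/(_ x): eTT; rewrite !inE -yE Ty.
move=> T T' /setIdP[sT _] /setIdP[sT' _] eTT.
by apply/eqP; rewrite eqEsubset (inj T T' sT eTT) (inj T' T sT' (esym eTT)).
Qed.

Definition F4 : {set F} := [set e | e ^+ 4 == e].

Lemma F4E : F4 = 0 |: mu3.
Proof.
apply/setP=> e; rewrite !inE -subr_eq0.
have -> : e ^+ 4 - e = e * (e ^+ 3 - 1) by ring.
by rewrite mulf_eq0 subr_eq0.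
Qed.

Lemma card_F4 : #|F4| = 4%N.
Proof. by rewrite F4E cardsU1 card_mu3 inE expr0n eq_sym oner_eq0. Qed.

Lemma mu3_F4 c : c \in mu3 -> c \in F4.
Proof. by rewrite F4E; apply: setU1r. Qed.

Lemma F4B e f : e \in F4 -> f \in F4 -> e - f \in F4.
Proof.
rewrite !inE => /eqP e4 /eqP f4; apply/eqP.
have -> : (e - f) ^+ 4 = e ^+ 4 - f ^+ 4 +
    2%:R * (f ^+ 4 - 2%:R * (e ^+ 3 * f + e * f ^+ 3) + 3%:R * (e ^+ 2 * f ^+ 2)).
  ring.
by rewrite two0 mul0r addr0 e4 f4.
Qed.

Lemma F4M e f : e \in F4 -> f \in F4 -> e * f \in F4.
Proof. by rewrite !inE exprMn => /eqP-> /eqP->. Qed.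

Lemma F4V e : e \in F4 -> e^-1 \in F4.
Proof. by rewrite !inE exprVn => /eqP->. Qed.

Definition F4_line v : {set F} := [set e * v | e in F4].

Lemma card_F4_line v : v != 0 -> #|F4_line v| = 4%N.
Proof. by move=> v0; rewrite card_imset ?card_F4 //; apply: mulIf. Qed.

Definition F4_span v x : {set F} := [set c * x + e * v | c in mu3, e in F4].

Lemma card_F4_span v x : v != 0 -> x \notin F4_line v -> #|F4_span v x| = 12%N.
Proof.
move=> v0 nx; rewrite /F4_span curry_imset2X card_in_imset.
  by rewrite cardsX card_mu3 card_F4.
move=> [c e] [c' e'] /setXP[/= mc fe] /setXP[/= mc' fe'] /= eq_ce.
have cc : (c - c') * x = (e' - e) * v.
  have -> : (c - c') * x = c * x + e * v - c' * x - e * v by ring.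
  by rewrite eq_ce; ring.
have ec : c = c'.
  apply/eqP; apply: contraNT nx; rewrite -subr_eq0 => cc0; apply/imsetP.
  exists ((c - c')^-1 * (e' - e)); first by rewrite F4M ?F4V ?F4B // mu3_F4.
  by rewrite -mulrA -cc mulKf.
congr (_, _) => //; apply: (mulIf v0); move: eq_ce; rewrite ec.
exact: addrI.
Qed.

Definition period (S : {set F}) v := [forall u in S, u + v \in S].

Lemma periodP S v : reflect {in S, forall u, u + v \in S} (period S v).
Proof. exact: forall_inP. Qed.

Lemma period_F4 S v e : S \in invariant12 -> period S v -> e \in F4 ->
  period S (e * v).
Proof.
move=> invS /periodP pv; rewrite F4E => /setU1P[->|mc]; apply/periodP => u Su.
  by rewrite mul0r addr0.
have e0 : e != 0.
  by apply: contraTneq mc => ->; rewrite inE expr0n eq_sym oner_eq0.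
have -> : u + e * v = e * (e^-1 * u + v) by rewrite mulrDr mulVKf.
apply: (invariant12_mu3 invS mc); apply: pv; apply: (invariant12_mu3 invS) => //.
by move: mc; rewrite !inE exprVn => /eqP->; rewrite invr1.
Qed.

(** The periods and the multiplications by mu3 carry x to all of F4_span v x,
    which has already as many elements as S.  If x were e v then x would be a
    period and x + x = 0 would be in S. *)
Lemma F4_span_eq S v x : S \in invariant12 -> v != 0 -> period S v -> x \in S ->
  x \notin F4_line v /\ F4_span v x = S.
Proof.
move=> invS v0 pv Sx; have [S0 S12 wS] := invariant12P _ invS.
have nx : x \notin F4_line v.
  apply: contraNN S0 => /imsetP[e F4e xE].
  have /periodP/(_ x Sx) := period_F4 invS pv F4e.
  by rewrite -xE -mulr2n -mulr_natl two0 mul0r.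
split=> //; apply/eqP; rewrite eqEcard card_F4_span // S12 leqnn andbT.
apply/subsetP => _ /imset2P[c e mc F4e ->].
have /periodP := period_F4 invS pv F4e; apply.
exact: invariant12_mu3.
Qed.

(** For x in S there are c and e with x + v' = c x + e v.  If c <> 1, then x is
    an F4-combination of the periods v and v', hence is a period itself, and
    x + x = 0 would be in S. *)
Lemma period_line S v v' : S \in invariant12 -> v != 0 -> period S v ->
  period S v' -> v' \in F4_line v.
Proof.
move=> invS v0 pv pv'; have [S0 S12 wS] := invariant12P _ invS.
have [x Sx] : exists x, x \in S by apply/set0Pn; rewrite -card_gt0 S12.
have [nx SE] := F4_span_eq invS v0 pv Sx.
have /periodP/(_ x Sx) := pv'; rewrite -SE => /imset2P[c e mc F4e xv].
have vE : v' = (c - 1) * x + e * v.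
  have -> : v' = x + v' - x by ring.
  by rewrite xv; ring.
have [c1|c1] := eqVneq c 1.
  by apply/imsetP; exists e; rewrite // vE c1 subrr mul0r add0r.
case/negP: S0; have cB1 : c - 1 != 0 by rewrite subr_eq0.
have F4c : (c - 1)^-1 \in F4.
  by rewrite F4V ?F4B ?mu3_F4 // inE expr1n.
have /periodP/(_ x Sx) p1 := period_F4 invS pv' F4c.
have F4ce : - ((c - 1)^-1 * e) \in F4.
  by rewrite -sub0r F4B ?F4M // inE expr0n.
have /periodP/(_ _ p1) := period_F4 invS pv F4ce.
suff -> : x + (c - 1)^-1 * v' + - ((c - 1)^-1 * e) * v = 0 by [].
rewrite vE mulrDr mulKf // mulrA mulNr -addrA addrK.
by rewrite -mulr2n -mulr_natl two0 mul0r.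
Qed.

Definition periodic12 : {set {set F}} :=
  [set S in invariant12 | [exists v, (v != 0) && period S v]].

Lemma F4_span_periodic v x : v != 0 -> x \notin F4_line v ->
  [/\ F4_span v x \in invariant12, period (F4_span v x) v & x \in F4_span v x].
Proof.
move=> v0 nx.
have F4_1 : 1 \in F4 by rewrite inE expr1n.
have F4_0 : 0 \in F4 by rewrite inE expr0n.
have F4D e f : e \in F4 -> f \in F4 -> e + f \in F4.
  by move=> Fe Ff; rewrite -[f]opprK F4B // -sub0r F4B.
have mu_w c : c \in mu3 -> w * c \in mu3.
  by rewrite !inE exprMn w3 mul1r.
have F4w : w \in F4 by rewrite mu3_F4 // inE w3.
split.
- apply/invariant12P; split; rewrite ?card_F4_span //.
    apply: contraNN nx => /imset2P[c e mc F4e ce0].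
    have c0 : c != 0.
      by apply: contraTneq mc => ->; rewrite inE expr0n eq_sym oner_eq0.
    apply/imsetP; exists (- (c^-1 * e)).
      by rewrite -sub0r F4B // F4M // F4V // mu3_F4.
    apply: (mulfI c0); rewrite mulNr mulrN !mulrA mulfV // mul1r.
    by apply/eqP; rewrite -addr_eq0 -ce0.
  move=> _ /imset2P[c e mc F4e ->]; apply/imset2P.
  exists (w * c) (w * e); rewrite ?mu_w ?F4M //.
  by rewrite mulrDr !mulrA.
- apply/periodP => _ /imset2P[c e mc F4e ->]; apply/imset2P.
  by exists c (e + 1); rewrite ?F4D // mulrDl mul1r addrA.
- apply/imset2P; exists 1 0; rewrite ?inE ?expr1n ?expr0n ?eqxx //.
  by rewrite mul1r mul0r addr0.
Qed.

(** A pair (v, x) with v <> 0 and x outside F4 v determines the periodic set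
    F4_span v x; conversely S comes from its 3 nonzero periods v and its 12
    points x. *)
Lemma card_periodic12 : (#|periodic12| * 36 = #|F|.-1 * (#|F| - 4))%N.
Proof.
pose P := [set p : F * F | (p.1 != 0) && (p.2 \notin F4_line p.1)].
have <- : #|P| = (#|F|.-1 * (#|F| - 4))%N.
  have -> : #|P| = (\sum_(v in [set~ 0%R]) \sum_(x in ~: F4_line v) 1)%N.
    by rewrite pair_big_dep -sum1_card; apply: eq_bigl => p; rewrite !inE.
  rewrite -(cardsC1 (0 : F)) -sum_nat_const; apply: eq_bigr => v.
  by rewrite in_setC1 => v0; rewrite sum1_card -(cardsC (F4_line v)) card_F4_line ?addKn.
rewrite -[RHS]sum1_card (partition_big (fun p : F * F => F4_span p.1 p.2) [in periodic12]) /=.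
  rewrite -sum_nat_const; apply/esym/eq_bigr => S /setIdP[invS /existsP[v]].
  case/andP=> v0 pv; have [S0 S12 wS] := invariant12P _ invS.
  have -> : 36%N = #|setX (F4_line v :\ 0) S|.
    rewrite cardsX S12; have := cardsD1 0 (F4_line v).
    rewrite card_F4_line //; have -> : 0 \in F4_line v.
      by apply/imsetP; exists 0; rewrite ?mul0r // inE expr0n.
    by rewrite add1n => -[<-].
  rewrite -sum1_card; apply: eq_bigl => -[v' x']; rewrite in_setX in_setD1 [_ \in P]inE /=.
  apply/andP/andP => [[/andP[v'0 nx'] /eqP SE]|[/andP[v'0 /imsetP[e F4e v'E]] Sx']].
    have [_] := F4_span_periodic v'0 nx'; rewrite SE => pv' ->.
    by rewrite v'0 (period_line invS v0 pv).
  have pv' : period S v' by rewrite v'E period_F4.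
  by have [-> ->] := F4_span_eq invS v'0 pv' Sx'; rewrite v'0.
case=> v x; rewrite inE /= => /andP[v0 nx].
have [invS pv _] := F4_span_periodic v0 nx.
by rewrite inE invS; apply/existsP; exists v; rewrite v0.
Qed.

End Counting.


(** * Orbits of blocks with a stabiliser of order 3 *)

Lemma pow2_mod3 n : (2 ^ n %% 3 = if odd n then 2 else 1)%N.
Proof.
by elim: n => // n IHn; rewrite expnS -modnMmr IHn /=; case: (odd n).
Qed.

Section OrbitCount.
Variable F : finFieldType.
Implicit Types (B : {set proj_line F}) (s g : {perm proj_line F}).

Lemma card_proj_line : #|{: proj_line F}| = #|F|.+1.
Proof. exact: card_option. Qed.

Lemma order3_card_fixT s : s \in PSL2 F -> #[s]%g = 3%N ->
  (#|'Fix_(setT | 'P)[s]%g| <= 2)%N /\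
  (#|F|.+1 = #|'Fix_(setT | 'P)[s]%g| %[mod 3])%N.
Proof.
move=> Gs s3; split.
  by apply: PSL2_card_fix; rewrite // -order_eq1 s3.
have p3 : (3.-group <[s]>)%g by rewrite /pgroup [#|_|]s3.
have nTs : s \in 'N([set: proj_line F] | 'P)%g.
  by apply/astabsP => x; rewrite !inE.
have := pgroup_fix_mod p3 (acts_cycle nTs).
by rewrite cardsT card_proj_line afix_cycle.
Qed.

Definition orbit3 : {set {set {set proj_line F}}} :=
  [set D in PSL2_orbits F 13 | is_design 3 13 572 D].

Lemma orbit3P (D : {set {set proj_line F}}) :
  reflect (exists B, [/\ #|B| = 13%N, #|block_stab B| = 3%N &
                         D = orbit 'P^*%act (PSL2 F) B])
          (D \in orbit3).
Proof.
rewrite inE; apply: (iffP andP) => [[/imsetP[B + ->]]|[B [B13 B3 ->]]].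
  rewrite inE => /eqP B13; rewrite design_stab // => B3; exists B; split=> //.
  by apply/eqP; rewrite -(eqn_pmul2l (isT : (0 < 572)%N)) (eqP B3).
rewrite design_stab // B3; split=> //.
by apply: imset_f; rewrite inE B13.
Qed.

Lemma block_stab_act B g : g \in PSL2 F ->
  block_stab ('P^*%act B g) = (block_stab B :^ g)%g.
Proof. by move=> Gg; rewrite !block_stabE astab1_act [RHS]conjIg (conjGid Gg). Qed.

Lemma card_stab_act B g : g \in PSL2 F ->
  #|block_stab ('P^*%act B g)| = #|block_stab B|.
Proof. by move=> Gg; rewrite block_stab_act // cardJg. Qed.

(** If q = 2 modulo 3 then 3 divides q + 1, so that an element of order 3 has
    no fixed point in the projective line, although it has one in the block. *)
Lemma orbit3_mod2 : (#|F| %% 3 = 2)%N -> orbit3 = set0.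
Proof.
move=> q2; apply/eqP; apply: contraTT isT => /set0Pn[_ /orbit3P[B [B13 B3 _]]].
have dvd3 : (3 %| #|block_stab B|)%N by rewrite B3.
have [s Hs s3] := Cauchy (isT : prime 3) dvd3.
have Gs : s \in PSL2 F by case/setIP: Hs.
have [le2] := order3_card_fixT Gs s3.
rewrite -addn1 -modnDml q2 => fix0.
have: (#|'Fix_(B | 'P)[s]%g| <= #|'Fix_(setT | 'P)[s]%g|)%N.
  by rewrite subset_leq_card // setSI // subsetT.
rewrite (order3_card_fix B13 Hs s3).
by case: #|_| le2 fix0 => [|[|[|k]]].
Qed.

Section Even.
Variable w : F.
Hypotheses (char2 : 2 \in [pchar F]) (w3 : w ^+ 3 = 1) (w1 : w != 1).

Let w0 : w != 0 := cube_root_neq0 w3.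

(** By good12_stab these are the sets whose block has a stabiliser of
    order 3. *)
Definition good12 : {set {set F}} := invariant12 w :\: periodic12 w.

Lemma scaling_perm c : c != 0 -> exists2 s, s \in PSL2 F &
  s None = None /\ forall u, s (Some u) = Some (c * u).
Proof.
move=> c0; have [s Gs [sN sE]] := affine_perm 0 c0.
by exists s => //; split=> // u; rewrite sE addr0.
Qed.

Lemma scaling_stab S c s : s \in PSL2 F -> s None = None ->
    (forall u, s (Some u) = Some (c * u)) ->
  (s \in block_stab (block S)) = [forall u in S, c * u \in S].
Proof.
move=> Gs sN sE; rewrite (@affine_stab _ S c 0) //; last first.
  by move=> u; rewrite sE addr0.
by apply: eq_forallb => u; rewrite addr0.
Qed.

Lemma good12P S : S \in good12 ->
  [/\ S \in invariant12 w, 0 \notin S, #|S| = 12%N,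
      {in S, forall u, w * u \in S} &
      forall v, {in S, forall u, u + v \in S} -> v = 0].
Proof.
case/setDP=> invS; rewrite inE invS /= => noP.
have [S0 S12 wS] := invariant12P _ _ invS; split=> // v pv.
apply/eqP; apply: contraNT noP => v0.
by apply/existsP; exists v; rewrite v0; apply/periodP.
Qed.

(** A translation has order 2, so it is not in a group of order 3. *)
Lemma good12_stab S : S \in invariant12 w ->
  (S \in good12) = (#|block_stab (block S)| == 3%N).
Proof.
move=> invS; apply/idP/eqP => [/good12P[_ S0 S12 wS noP]|H3].
  exact: (card_stab_no_trans char2 w3 w1 S0 S12 wS noP).
rewrite inE invS andbT inE invS; apply/existsP => -[v /andP[v0 /periodP pv]].
have [t Gt [tN tE]] := affine_perm v (oner_neq0 F).
have Ht : t \in block_stab (block S).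
  rewrite (affine_stab _ Gt tN tE); apply/forall_inP => u Su.
  by rewrite mul1r pv.
have: (t ^+ 3)%g (Some 0) = Some 0 by rewrite -H3 expg_cardG // perm1.
rewrite permX /= !tE !mul1r add0r => -[].
by rewrite (addrr_pchar2 char2) add0r => /eqP; rewrite (negPf v0).
Qed.

(** The stabiliser has no more elements than its subgroup fixing infinity. *)
Lemma good12_stab_scaling S s : S \in good12 -> s \in block_stab (block S) ->
  exists2 a, a \in mu3 F & s None = None /\ forall u, s (Some u) = Some (a * u).
Proof.
move=> goodS Hs; have [invS S0 S12 wS noP] := good12P goodS.
have Hoo3 := card_stab_inf char2 w3 w1 S0 S12 wS noP.
have H3 := card_stab_no_trans char2 w3 w1 S0 S12 wS noP.
have HooE : 'C_(block_stab (block S))[None | 'P]%g = block_stab (block S).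
  by apply/eqP; rewrite eqEcard subsetIl H3 Hoo3.
rewrite -HooE in Hs.
have [a a3 sE] := stab_inf_cubic char2 w3 w1 S0 S12 wS noP Hs.
exists a; first by rewrite inE a3.
by case/setIP: Hs => _ /astab1P.
Qed.

(** The two fixed points of an element of order 3 of the stabiliser are carried
    to infinity and 0, the one in B going to infinity; then this element becomes
    the multiplication by w or by its inverse. *)
Lemma orbit3_normal_form B : #|B| = 13%N -> #|block_stab B| = 3%N ->
  exists2 S, S \in good12 & block S \in orbit 'P^*%act (PSL2 F) B.
Proof.
move=> B13 B3.
have dvd3 : (3 %| #|block_stab B|)%N by rewrite B3.
have [h Hh h3] := Cauchy (isT : prime 3) dvd3.
have Gh : h \in PSL2 F by case/setIP: Hh.
have [p fixB] : exists p, 'Fix_(B | 'P)[h]%g = [set p].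
  by apply/cards1P; rewrite (order3_card_fix B13 Hh h3).
have [Bp /afix1P hp] : p \in B /\ p \in 'Fix_('P)([set h])%g.
  by apply/setIP; rewrite fixB set11.
have [le2 fixX] := order3_card_fixT Gh h3.
(* The number of fixed points is at most 2 and congruent to q + 1 = 2
   modulo 3. *)
have [p' np' /afix1P hp'] :
    exists2 p', p' != p & p' \in 'Fix_('P)([set h])%g.
  have : (1 < #|'Fix_(setT | 'P)[h]%g|)%N.
    move: fixX le2; rewrite -(prednK (ltnW (finNzRing_gt1 F))).
    rewrite -(card_cubes w3 w1) -addn2 modnMDl.
    by case: #|_| => [|[|k]].
  case/card_gt1P=> x [y [/setIP[_ hx] /setIP[_ hy] nxy]].
  by have [xp|] := eqVneq x p; [exists y; rewrite // -xp eq_sym | exists x].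
have fixp u : u \in B -> h u = u -> u = p.
  by move=> Bu hu; apply/set1P; rewrite -fixB inE Bu; apply/afix1P.
have [r /setD1P[nrp Br]] : exists r, r \in B :\ p.
  by apply/set0Pn; rewrite -card_gt0; have := cardsD1 p B; rewrite B13 Bp; case: #|_|.
have nrp' : p' != r.
  by apply: contraNneq np' => p'r; apply/eqP/fixp; rewrite // p'r.
have [g Gg [gp gp' _]] : exists2 g, g \in PSL2 F &
    [/\ g p = None, g p' = Some 0 & g r = Some 1].
  by apply: PSL2_to_std; rewrite // eq_sym.
pose B' := 'P^*%act B g; pose S := [set u | Some u \in B'].
have BS : block S = B'.
  apply/setP=> -[u|]; rewrite ?block_some ?block_inf ?inE //.
  by rewrite -gp -[g p]/('P%act p g) mem_setact.
have B'3 : #|block_stab B'| = 3%N by rewrite card_stab_act.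
have S12 : #|S| = 12%N.
  by apply/eqP; rewrite -eqSS -card_block BS card_setact B13.
have hJ x : h x = x -> (h ^ g)%g (g x) = g x.
  by move=> hx; rewrite conjgE !permM permK hx.
have hJN : (h ^ g)%g None = None by rewrite -gp hJ.
have hJ0 : (h ^ g)%g (Some 0) = Some 0 by rewrite -gp' hJ.
have S0 : 0 \notin S.
  rewrite inE -gp'; apply: contraNN np' => /imsetP[x Bx].
  by rewrite /= apermE => /perm_inj p'x; apply/eqP/fixp; rewrite // p'x.
have GhJ : (h ^ g)%g \in PSL2 F by rewrite groupJ.
have [a [b [a0 hJE]]] := PSL2_affine GhJ hJN.
have {hJ0}b0 : b = 0 by move: hJ0; rewrite hJE mulr0 add0r => -[].
have HhJ : (h ^ g)%g \in block_stab B'.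
  by rewrite block_stab_act ?memJ_conjg.
have aS : {in S, forall u, a * u \in S}.
  move: HhJ; rewrite -BS (affine_stab _ GhJ hJN hJE) => /forall_inP aS u Su.
  by rewrite -[a * u]addr0 -b0 aS.
have hJ3 : ((h ^ g) ^+ 3 = 1)%g by rewrite -conjXg -h3 expg_order conj1g.
have a3 : a \in mu3 F.
  have: ((h ^ g) ^+ 3)%g (Some 1) = Some 1 by rewrite hJ3 perm1.
  rewrite permX /= !hJE b0 !addr0 mulr1 => -[aaa].
  by rewrite inE !exprS expr0 mulr1 aaa.
have a1 : a != 1.
  apply: contra_eq_neq h3 => a1; suff /eqP : (h ^ g)%g = 1%g.
    by rewrite conjg_eq1 => /eqP->; rewrite order1.
  by apply/permP=> -[u|]; rewrite perm1 // hJE b0 a1 mul1r addr0.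
have wS : {in S, forall u, w * u \in S}.
  move: a3 aS; rewrite (mu3_enum w3 w1) !inE (negPf a1) /= => /orP[]/eqP-> // aS u Su.
  suff -> : w * u = w ^+ 2 * (w ^+ 2 * u) by rewrite !aS.
  by rewrite mulrA -exprD exprS w3 mulr1.
have invS : S \in invariant12 w by apply/invariant12P.
exists S; first by rewrite good12_stab // BS B'3.
by rewrite BS mem_orbit.
Qed.

Definition scale c (S : {set F}) : {set F} := [set c * u | u in S].

Lemma block_scale c S s : s None = None ->
    (forall u, s (Some u) = Some (c * u)) ->
  'P^*%act (block S) s = block (scale c S).
Proof.
move=> sN sE; rewrite /= /setact imsetU1 /= apermE sN /block /scale -!imset_comp.
by congr (_ |: _); apply: eq_imset => u; rewrite /= apermE sE.
Qed.

Lemma scale_good12 c S : c != 0 -> S \in good12 -> scale c S \in good12.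
Proof.
move=> c0 goodS; have [invS S0 S12 wS _] := good12P goodS.
have [s Gs [sN sE]] := scaling_perm c0.
have invcS : scale c S \in invariant12 w.
  apply/invariant12P; split.
  - apply: contraNN S0 => /imsetP[u Su /esym/eqP].
    by rewrite mulf_eq0 (negPf c0) => /eqP <-.
  - by rewrite card_imset //; apply: mulfI.
  - by move=> _ /imsetP[u Su ->]; rewrite mulrCA imset_f ?wS.
by rewrite good12_stab // -(block_scale S sN sE) card_stab_act // -good12_stab.
Qed.

(** An element carrying one block to the other conjugates their stabilisers,
    so it permutes the fixed points infinity and 0 of these groups; it fixes
    both of them, since only infinity is in the blocks. *)
Lemma good12_orbit_scale S S' : S \in good12 -> S' \in good12 ->
  block S' \in orbit 'P^*%act (PSL2 F) (block S) ->
  exists2 c, c != 0 & S' = scale c S.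
Proof.
move=> goodS goodS' /imsetP[g Gg gE].
have [invS S0 S12 wS _] := good12P goodS.
have [_ S'0 _ _ _] := good12P goodS'.
have [h Gh [hN hE]] := scaling_perm w0.
have Hh : h \in block_stab (block S).
  by rewrite (scaling_stab _ Gh hN hE); apply/forall_inP.
have HhJ : (h ^ g)%g \in block_stab (block S').
  by rewrite gE block_stab_act ?memJ_conjg.
have [a _ [hJN hJE]] := good12_stab_scaling goodS' HhJ.
have hJ x : h x = x -> (h ^ g)%g (g x) = g x.
  by move=> hx; rewrite conjgE !permM permK hx.
have a1 : a != 1.
  apply: contra_neq w1 => a1; suff /eqP : (h ^ g)%g = 1%g.
    rewrite conjg_eq1 => /eqP h1; have := hE 1.
    by rewrite h1 perm1 mulr1 => -[].
  by apply/permP=> -[u|]; rewrite perm1 // hJE a1 mul1r.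
have fixJ u : (h ^ g)%g (Some u) = Some u -> u = 0.
  rewrite hJE => -[] /eqP; rewrite -subr_eq0 -{2}[u]mul1r -mulrBl mulf_eq0.
  by rewrite subr_eq0 (negPf a1) => /eqP.
have gN : g None = None.
  case E: (g None) => [u|] //; have := hJ _ hN; rewrite E => /fixJ u0.
  case/negP: S'0; rewrite -u0 -block_some -E gE.
  exact: (mem_setact 'P _ (block_inf S)).
have h0 : h (Some 0) = Some 0 by rewrite hE mulr0.
have g0 : g (Some 0) = Some 0.
  case E: (g (Some 0)) => [u|]; last by have := perm_inj (etrans E (esym gN)).
  by have := hJ _ h0; rewrite E => /fixJ->.
have [c [b [c0 gcE]]] := PSL2_affine Gg gN.
have b0 : b = 0 by move: g0; rewrite gcE mulr0 add0r => -[].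
have {}gcE u : g (Some u) = Some (c * u) by rewrite gcE b0 addr0.
by exists c => //; apply: block_inj; rewrite gE (block_scale S gN gcE).
Qed.

Lemma scale_stabilizer c c' S : S \in good12 -> c != 0 -> c' != 0 ->
  (scale c' S == scale c S) = (c' / c \in mu3 F).
Proof.
move=> goodS c0 c'0; have [invS S0 S12 wS _] := good12P goodS.
apply/eqP/idP => [eS | mc].
  have cc0 : c' / c != 0 by rewrite mulf_neq0 ?invr_eq0.
  have [s Gs [sN sE]] := scaling_perm cc0.
  have Hs : s \in block_stab (block S).
    rewrite (scaling_stab _ Gs sN sE); apply/forall_inP => u Su.
    have : c' * u \in scale c S by rewrite -eS imset_f.
    by case/imsetP=> v Sv cuv; rewrite mulrAC cuv mulrAC divff ?mul1r.
  have [a ma [_ saE]] := good12_stab_scaling goodS Hs.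
  by have := saE 1; rewrite sE !mulr1 => -[->].
apply/eqP; rewrite eqEcard !card_imset ?leqnn ?andbT; try exact: mulfI.
apply/subsetP=> _ /imsetP[u Su ->]; apply/imsetP; exists (c' / c * u).
  exact: (invariant12_mu3 w3 w1 invS).
by rewrite mulrA [c * _]mulrC divfK.
Qed.

(** The q - 1 scalars act on these sets with stabiliser mu3, and
    (q - 1) / 3 is the number of nonzero cubes. *)
Lemma card_good12_orbit S : S \in good12 ->
  #|[set S' in good12 | block S' \in orbit 'P^*%act (PSL2 F) (block S)]| =
    #|cubes F|.
Proof.
move=> goodS; set E := [set S' in _ | _].
have -> : E = scale^~ S @: [set~ 0].
  apply/setP=> S'; rewrite inE; apply/andP/imsetP => [[goodS' orbS']|[c]].
    have [c c0 ->] := good12_orbit_scale goodS goodS' orbS'.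
    by exists c; rewrite // !inE.
  rewrite in_setC1 => c0 ->; split; first exact: scale_good12.
  have [s Gs [sN sE]] := scaling_perm c0.
  by rewrite -(block_scale S sN sE) mem_orbit.
apply/eqP; rewrite -(eqn_pmul2r (isT : 0 < 3)%N) (card_cubes w3 w1).
rewrite -(cardsC1 (0 : F)) -[X in _ == X]sum1_card (partition_big_imset (scale^~ S)) /=.
rewrite -sum_nat_const; apply/eqP/eq_bigr => _ /imsetP[c + ->].
rewrite !inE => c0; rewrite -(card_mu3 w3 w1) -(card_imset (mu3 F) (mulfI c0)).
rewrite -sum1_card; apply: eq_bigl => c'; rewrite !inE.
apply/imsetP/andP => [[m mm ->]|[c'0]].
  have m0 : m != 0.
    by apply: contraTneq mm => ->; rewrite inE expr0n eq_sym oner_eq0.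
  by rewrite mulf_neq0 // scale_stabilizer ?mulf_neq0 // mulrAC divff ?mul1r.
by rewrite scale_stabilizer // => mm; exists (c' / c); rewrite // mulrC divfK.
Qed.

Lemma card_orbit3_cubes : (#|orbit3| * #|cubes F|)%N = #|good12|.
Proof.
rewrite -[RHS]sum1_card.
rewrite (partition_big (fun S => orbit 'P^*%act (PSL2 F) (block S)) [in orbit3]) /=.
  rewrite -sum_nat_const; apply: eq_bigr => D /orbit3P[B [B13 B3 ->]].
  have [S goodS orbS] := orbit3_normal_form B13 B3.
  rewrite -(card_good12_orbit goodS) -sum1_card; apply: eq_bigl => S'.
  rewrite inE; congr (_ && _); move/orbit_eqP: orbS => <-.
  by apply/idP/eqP => [/orbit_eqP|/orbit_eqP].
move=> S goodS; have [invS S0 S12 _ _] := good12P goodS.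
apply/orbit3P; exists (block S); rewrite card_block S12; split=> //.
by apply/eqP; rewrite -good12_stab.
Qed.

Lemma card_good12 : (#|good12| + #|periodic12 w| = 'C(#|cubes F|, 4))%N.
Proof.
rewrite -(card_invariant12 w3 w1) addnC -(cardsID (periodic12 w) (invariant12 w)).
by congr (#|pred_of_set _| + _)%N; apply/esym/setIidPr/subsetP => S /setIdP[].
Qed.

End Even.
End OrbitCount.

Lemma ffact4_natr n :
  (n ^_ 4)%:R = n%:R * (n%:R - 1) * (n%:R - 2) * (n%:R - 3) :> rat.
Proof.
case: n => [|[|[|[|n]]]]; first [by rewrite ffact_small //; ring | idtac].
by rewrite !ffactSS ffactn0 !natrM; ring.
Qed.

Lemma exists_cube_root (F : finFieldType) : (3 %| #|F|.-1)%N ->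
  exists2 w : F, w ^+ 3 = 1 & w != 1.
Proof.
rewrite -card_finField_unit => /(Cauchy (isT : prime 3))[u _ u3].
exists (val u); first by rewrite -FinRing.val_unitX -u3 expg_order.
by apply: contra_eq_neq u3 => u1; suff ->: u = 1%g; [rewrite order1 | apply: val_inj].
Qed.

Theorem proposition5p22 (n : nat) (F : finFieldType) (n_ge1 : (1 <= n)%N)
    (cardF : #|F| = (2 ^ n)%N) :
  (m_lambda F 13 572)%:R =
  (if odd n then 0
   else (2 ^+ n - 1) * (2 ^+ n - 4) * (2 ^+ n - 16) / 648) :> rat.
Proof.
have mE : m_lambda F 13 572 = #|orbit3 F| by [].
have := pow2_mod3 n; case: ifP => n_odd F3.
  by rewrite mE orbit3_mod2 ?cards0 // cardF.
have char2 : 2 \in [pchar F] := card_finPcharP cardF isT.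
have [|w w3 w1] := @exists_cube_root F.
  by rewrite -subn1 -eqn_mod_dvd ?cardF ?expn_gt0 // F3.
have cardc := card_cubes w3 w1.
have cardm := card_orbit3_cubes char2 w3 w1.
have cardg := card_good12 w3 w1.
have cardp := card_periodic12 char2 w3 w1.
have cardb := bin_ffact #|cubes F| 4.
have qE : #|F| = (3 * #|cubes F|).+1.
  by rewrite mulnC cardc prednK // cardF expn_gt0.
have r_gt0 : (0 < #|cubes F|)%N.
  by rewrite lt0n; apply: contraTneq (finNzRing_gt1 F) => r0; rewrite qE r0.
move: cardm cardg cardp cardb; rewrite -natrX -cardF qE mE /=.
move: #|orbit3 F| #|good12 w| #|periodic12 w| ('C(_, _)) r_gt0 => m N p C.
case: #|cubes F| => // r _ cardm cardg cardp cardb.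
have eg : (m%:R * (r%:R + 1) + p%:R) * 24 =
    (r%:R + 1) * r%:R * (r%:R - 1) * (r%:R - 2) :> rat.
  have := ffact4_natr r.+1; rewrite -cardb -cardg -cardm natrM natrD natrM.
  by rewrite -[r.+1]addn1 natrD => ->; ring.
have ep : p%:R * 36 = 9 * (r%:R + 1) * r%:R :> rat.
  have sub4 : ((3 * r.+1).+1 - 4 = 3 * r)%N by rewrite mulnS subSS addKn.
  by rewrite -[36]/(36%:R) -natrM cardp sub4 !natrM -[r.+1]addn1 natrD; ring.
have r1 : r%:R + 1 != 0 :> rat by rewrite natr1 Num.Theory.pnatr_eq0.
have qE' : (3 * r.+1).+1%:R = 3 * (r%:R + 1) + 1 :> rat.
  by rewrite !natr1 -natrM natr1.
apply: (mulIf r1); rewrite qE'; lra.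
Qed.
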